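(* Let $R$ be a semiprime ring, let $I$ be a nonzero ideal of $R$, and let $d:R\to R$ be a multiplicative semiderivation associated with a nonzero epimorphism $g$ of $R$. If $d(xy)\pm xy=0$ for all $x,y\in I$ (that is, either $d(xy)+xy=0$ for all $x,y\in I$, or $d(xy)-xy=0$ for all $x,y\in I$), then $[x,d(x)]=0$ for all $x\in I$.
   Context: Rings are associative and not assumed unital or commutative; ideals are two-sided. A ring $R$ is semiprime if for $x\in R$, $xRx=0$ implies $x=0$. For $x,y\in R$, $[x,y]=xy-yx$. A mapping $d:R\to R$ (not assumed additive) is a multiplicative semiderivation associated with a function $g:R\to R$ if (i) $d(xy)=d(x)g(y)+xd(y)=d(x)y+g(x)d(y)$ and (ii) $d(g(x))=g(d(x))$ hold for all $x,y\in R$. An epimorphism of $R$ is a surjective ring homomorphism $R\to R$; nonzero means not the zero map. *)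

(* Defs.v *)
From HB Require Import structures.
From mathcomp Require Import all_boot ssralg.

Set Implicit Arguments.
Unset Strict Implicit.
Unset Printing Implicit Defensive.

Local Open Scope ring_scope.

(* The rings of ssralg are all unital, so non-unital rings are built here as
   additive groups that are also multiplicative semigroups, with
   distributivity. The product [x ** y] is the semigroup law of [monoid], with
   lemmas such as [mulgA]; it is not written [x * y] because in ring_scope that
   denotes the product of a unital ring. *)
Reserved Notation "x ** y" (at level 40, left associativity).
Notation "x ** y" := (monoid.mul x y) : ring_scope.

HB.mixin Record Zmodule_Semigroup_isRng R of GRing.Zmodule R & Semigroup R := {
  rng_mulDl : left_distributive (@monoid.mul R) (@GRing.add R);
  rng_mulDr : right_distributive (@monoid.mul R) (@GRing.add R)
}.

#[short(type="rngType")]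
HB.structure Definition Rng :=
  {R of Zmodule_Semigroup_isRng R & GRing.Zmodule R & Semigroup R}.

Bind Scope ring_scope with Rng.sort.

Definition semiprime (R : rngType) : Prop :=
  forall x : R, (forall r : R, x ** r ** x = 0) -> x = 0.

Definition ideal (R : rngType) (I : R -> Prop) : Prop :=
  [/\ I 0,
      forall x y : R, I x -> I y -> I (x - y),
      forall r x : R, I x -> I (r ** x)
    & forall x r : R, I x -> I (x ** r)].

Definition nonzero_ideal (R : rngType) (I : R -> Prop) : Prop :=
  ideal I /\ exists2 x : R, I x & x <> 0.

Definition commutator (R : rngType) (x y : R) : R := x ** y - y ** x.

Definition epimorphism (R : rngType) (g : R -> R) : Prop :=
  [/\ {morph g : x y / x + y},
      {morph g : x y / x ** y}
    & forall y : R, exists x : R, g x = y].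

Definition multiplicative_semiderivation (R : rngType) (d g : R -> R) : Prop :=
  [/\ forall x y : R, d (x ** y) = d x ** g y + x ** d y,
      forall x y : R, d (x ** y) = d x ** y + g x ** d y
    & forall x : R, d (g x) = g (d x)].

(* Main.v *)
(* Expanding d(xyz) for x, y, z in I in two ways gives d(x) J^2 = 0 = J^2 d(x)
   for the ideal J = g(I), and semiprimeness improves this to
   d(x) J = 0 = J d(x). Comparing the two expansions of d(x^2) shows that
   [x, d(x)] = g(x) d(x) - d(x) g(x), where both terms vanish. *)
Require Import Defs.
From mathcomp Require Import all_boot ssralg.

Local Open Scope ring_scope.

Import GRing.Theory.

Section RngTheory.
Variable R : rngType.
Implicit Types x y : R.

Lemma rng_mulr0 x : x ** 0 = 0.
Proof. by apply: (addrI (x ** 0)); rewrite -rng_mulDr !addr0. Qed.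

Lemma rng_mul0r x : 0 ** x = 0.
Proof. by apply: (addrI (0 ** x)); rewrite -rng_mulDl !addr0. Qed.

Lemma rng_mulrN x y : x ** (- y) = - (x ** y).
Proof. by apply: (addrI (x ** y)); rewrite -rng_mulDr !subrr rng_mulr0. Qed.

Lemma rng_mulNr x y : (- x) ** y = - (x ** y).
Proof. by apply: (addrI (x ** y)); rewrite -rng_mulDl !subrr rng_mul0r. Qed.

End RngTheory.

Section SemiprimeImage.
Variables (R : rngType) (I : R -> Prop) (g : R -> R).
Hypotheses (spR : semiprime R) (idI : ideal I) (epi_g : epimorphism g).

(** Since [g] is onto, [r ** a] equals some [g s], so [a ** g y ** r ** (a ** g y)] is
    [a ** (g (y ** s) ** g y)]. This vanishes because [y ** s] stays in [I], and semiprimeness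
    applies. *)
Lemma semiprime_lann_image (a : R) :
  (forall y z, I y -> I z -> a ** (g y ** g z) = 0) ->
  forall y, I y -> a ** g y = 0.
Proof.
case: idI epi_g => _ _ _ Ir [_ gM g_surj] aJJ y Iy; apply: spR => r.
have [s gs] := g_surj (r ** a).
suff -> : a ** g y ** r ** (a ** g y) = a ** (g (y ** s) ** g y).
  by apply: aJJ => //; apply: Ir.
by rewrite gM gs !mulgA.
Qed.

(** Mirror image: now [a ** r] is lifted to [s], and [s ** y] stays in [I]. *)
Lemma semiprime_rann_image (a : R) :
  (forall y z, I y -> I z -> g y ** g z ** a = 0) ->
  forall y, I y -> g y ** a = 0.
Proof.
case: idI epi_g => _ _ Il _ [_ gM g_surj] JJa y Iy; apply: spR => r.
have [s gs] := g_surj (a ** r).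
suff -> : g y ** a ** r ** (g y ** a) = g y ** g (s ** y) ** a.
  by apply: JJa => //; apply: Il.
by rewrite gM gs !mulgA.
Qed.

(** The two conditions on triple products are what both signs of the theorem have in common. *)
Lemma semiderivation_commuting (d : R -> R) :
    multiplicative_semiderivation d g ->
    (forall x y z, I x -> I y -> I z -> d (x ** (y ** z)) = x ** d (y ** z)) ->
    (forall x y z, I x -> I y -> I z -> d (x ** y ** z) = d (x ** y) ** z) ->
  forall x, I x -> commutator x (d x) = 0.
Proof.
case: epi_g => _ gM _ [dMg dgM _] dMl dMr x Ix.
have dJ : d x ** g x = 0.
  apply: semiprime_lann_image (Ix) => y z Iy Iz.
  (* With this term added, the left side is the expansion of [d (x ** (y ** z))] through [dMg]. *)
  apply: (addIr (x ** d (y ** z))).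
  by rewrite -gM -dMg dMl // add0r.
have Jd : g x ** d x = 0.
  apply: semiprime_rann_image (Ix) => y z Iy Iz.
  (* Likewise for [d (y ** z ** x)], now expanded through [dgM]. *)
  apply: (addrI (d (y ** z) ** x)).
  by rewrite -gM -dgM dMr // addr0.
apply/eqP; rewrite /commutator subr_eq0; apply/eqP.
by have := dMg x x; rewrite dgM dJ Jd addr0 add0r.
Qed.

End SemiprimeImage.

Theorem theorem3 (R : rngType) (I : R -> Prop) (d g : R -> R) :
  semiprime R ->
  nonzero_ideal I ->
  epimorphism g ->
  (exists x : R, g x <> 0) ->
  multiplicative_semiderivation d g ->
  (forall x y : R, I x -> I y -> d (x ** y) + x ** y = 0) \/
  (forall x y : R, I x -> I y -> d (x ** y) - x ** y = 0) ->
  forall x : R, I x -> commutator x (d x) = 0.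
Proof.
move=> spR [idI _] epi_g _ sd_d dI.
have [_ _ _ Ir] := idI.
case: dI => dI.
  (* On products from [I], [d] is negation, and the sign passes through an outer factor on either
     side. *)
  have dE u v : I u -> I v -> d (u ** v) = - (u ** v).
    by move=> Iu Iv; apply/eqP; rewrite -addr_eq0 dI.
  apply: (semiderivation_commuting R I g) => // x y z Ix Iy Iz.
    by rewrite !dE ?rng_mulrN //; apply: Ir.
  by rewrite !dE ?rng_mulNr //; apply: Ir.
(* Here [d] fixes products from [I], so both conditions reduce to identities. *)
have dE u v : I u -> I v -> d (u ** v) = u ** v.
  by move=> Iu Iv; apply/eqP; rewrite -subr_eq0 dI.
apply: (semiderivation_commuting R I g) => // x y z Ix Iy Iz.
  by rewrite !dE //; apply: Ir.
by rewrite !dE //; apply: Ir.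
Qed.
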